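(* Consider a homogeneous linear wave equation of order at most two $$a^{\mu\nu}\partial_\mu\partial_\nu\Psi+b^\mu\partial_\mu\Psi+f\,\Psi=0$$ with constant complex coefficients $a^{\mu\nu},b^\mu$ and a function $f(\mathbf r,t)$. If the equation is Galilean covariant (in the sense defined in the context), then it contains no second order time derivative, i.e. $a^{00}=0$.
   Context: Notation: $x^0=ct$, $(x^1,x^2,x^3)=\mathbf r=(x,y,z)$, $\partial_\mu=\partial/\partial x^\mu$, $\mu=0,1,2,3$, repeated indices are summed; $c>0$ is the speed of light. The unknown $\Psi(\mathbf r,t)$ is complex-valued; write $L\Psi:=a^{\mu\nu}\partial_\mu\partial_\nu\Psi+b^\mu\partial_\mu\Psi+f\Psi$. Frames: a rotation relates $S$ and $S'$ by $\mathbf r'=M\mathbf r$, $t'=t$, $M\in SO(3)$; a Galilean boost with velocity $\mathbf v\in\mathbb{R}^3$ by $t=t'$, $\mathbf r=\mathbf r'+\mathbf v t'$. The function $f$ is a strict scalar: $f'(\mathbf r',t')=f(\mathbf r,t)$. Under rotations wave functions transform as $\Psi(\mathbf r,t)=\Psi'(\mathbf r',t')$; under a boost with velocity $\mathbf v$ they transform as $\Psi(\mathbf r,t)=g_{\mathbf v}(\mathbf r',t')\Psi'(\mathbf r',t')$, where $g_{\mathbf v}$ is some smooth, nowhere vanishing complex-valued function. Galilean covariance: for every rotation and every boost, substituting the transformation law into $L\Psi$ and expressing everything in primed variables gives, for every smooth $\Psi'$, a nowhere vanishing function (independent of $\Psi'$) times $a^{\mu\nu}\partial_{\mu'}\partial_{\nu'}\Psi'+b^\mu\partial_{\mu'}\Psi'+f'\Psi'$,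 with the same constants $a^{\mu\nu},b^\mu$. *)

(* Defs.v *)
From HB Require Import structures.
From mathcomp Require Import all_boot all_order all_algebra.
From mathcomp Require Import all_classical all_reals all_analysis.
From mathcomp Require Import complex.

Set Implicit Arguments.
Unset Strict Implicit.
Unset Printing Implicit Defensive.

Import Order.TTheory GRing.Theory Num.Theory.
Import numFieldNormedType.Exports.

Local Open Scope classical_set_scope.
Local Open Scope ring_scope.
Local Open Scope complex_scope.

(* Space-time points are the columns (x^0, x^1, x^2, x^3) with x^0 = c t. *)

Definition time (R : realType) (c : R) (x : 'cV[R]_4) : R := x ord0 ord0 / c.

Definition position (R : realType) (x : 'cV[R]_4) : 'cV[R]_3 :=
  dsubmx (x : 'cV[R]_(1 + 3)).

Definition partial (R : realType) (mu : 'I_4) (F : 'cV[R]_4 -> R) :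
    'cV[R]_4 -> R :=
  'D_(delta_mx mu ord0) F.

Definition Re_fun (R : realType) (F : 'cV[R]_4 -> R[i]) : 'cV[R]_4 -> R :=
  fun x => complex.Re (F x).

Definition Im_fun (R : realType) (F : 'cV[R]_4 -> R[i]) : 'cV[R]_4 -> R :=
  fun x => complex.Im (F x).

(* R[i] has no normed R-module structure in the library, so real derivatives
   of complex-valued functions are taken componentwise. *)
Definition cpartial (R : realType) (mu : 'I_4) (F : 'cV[R]_4 -> R[i]) :
    'cV[R]_4 -> R[i] :=
  fun x => partial mu (Re_fun F) x +i* partial mu (Im_fun F) x.

Fixpoint times_differentiable (R : realType) (n : nat) (F : 'cV[R]_4 -> R) :
    Prop :=
  if n is m.+1 then
    (forall x, differentiable F x) /\
    (forall mu, times_differentiable m (partial mu F))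
  else True.

Definition smooth (R : realType) (F : 'cV[R]_4 -> R[i]) : Prop :=
  forall n, times_differentiable n (Re_fun F) /\
            times_differentiable n (Im_fun F).

Definition wave_op (R : realType) (a : 'M[R[i]]_4) (b : 'cV[R[i]]_4)
    (f Psi : 'cV[R]_4 -> R[i]) : 'cV[R]_4 -> R[i] :=
  fun x =>
    \sum_(mu < 4) \sum_(nu < 4) a mu nu * cpartial mu (cpartial nu Psi) x
    + \sum_(mu < 4) b mu ord0 * cpartial mu Psi x
    + f x * Psi x.

(* A change of frame is the relation between the coordinates x in S and x' in
   S' of the same event. *)

Definition rotation_frame (R : realType) (c : R) (M : 'M[R]_3)
    (x x' : 'cV[R]_4) : Prop :=
  position x' = M *m position x /\ time c x' = time c x.

Definition boost_frame (R : realType) (c : R) (v : 'cV[R]_3)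
    (x x' : 'cV[R]_4) : Prop :=
  time c x = time c x' /\ position x = position x' + time c x' *: v.

Definition special_orthogonal (R : realType) (M : 'M[R]_3) : Prop :=
  M^T *m M = 1%:M /\ \det M = 1.

Definition nowhere_vanishing (R : realType) (F : 'cV[R]_4 -> R[i]) : Prop :=
  forall x, F x != 0.

(* For c <> 0 a frame relation is a bijection, so f' and Psi below are determined by
   f and by g, Psi' respectively. *)
Definition covariant_under (R : realType) (frame : 'cV[R]_4 -> 'cV[R]_4 -> Prop)
    (g : 'cV[R]_4 -> R[i])
    (a : 'M[R[i]]_4) (b : 'cV[R[i]]_4) (f : 'cV[R]_4 -> R[i]) : Prop :=
  forall f' : 'cV[R]_4 -> R[i],
  (forall x x', frame x x' -> f' x' = f x) ->
  exists lambda : 'cV[R]_4 -> R[i],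
    nowhere_vanishing lambda /\
    forall Psi Psi' : 'cV[R]_4 -> R[i],
      smooth Psi' ->
      (forall x x', frame x x' -> Psi x = g x' * Psi' x') ->
      forall x x', frame x x' ->
        wave_op a b f Psi x = lambda x' * wave_op a b f' Psi' x'.

Definition galilean_covariant (R : realType) (c : R)
    (a : 'M[R[i]]_4) (b : 'cV[R[i]]_4) (f : 'cV[R]_4 -> R[i]) : Prop :=
  (forall M : 'M[R]_3, special_orthogonal M ->
     covariant_under (rotation_frame c M) (fun=> 1) a b f) /\
  (forall v : 'cV[R]_3, exists g : 'cV[R]_4 -> R[i],
     [/\ smooth g, nowhere_vanishing g &
         covariant_under (boost_frame c v) g a b f]).

(* Main.v *)
Require Import Defs.
From mathcomp Require Import all_boot all_order all_algebra.
From mathcomp Require Import all_classical all_reals all_analysis.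
From mathcomp Require Import complex.
From mathcomp Require Import ring.

Import Order.TTheory GRing.Theory Num.Theory.
Import numFieldNormedType.Exports.

Local Open Scope ring_scope.
Local Open Scope complex_scope.

(** Compare principal symbols.  If a boost with matrix [B] is accompanied by the
    factor [g], then testing covariance at the origin on the functions
    [x_i x_j], which vanish there to second order, gives
    [g(0) B S B^T = lambda(0) S] for the symmetric part [S = a + a^T].  The
    boost with velocity [c e_1] sends [(x_0, x_1)] to [(x_0, x_1 - x_0)], so the
    entry [(0,0)] reads [g(0) S_00 = lambda(0) S_00] and the entry [(0,1)] reads
    [g(0) (S_01 - S_00) = lambda(0) S_01].  If [S_00] were nonzero the first
    equation would give [g(0) = lambda(0)] and the second [S_00 = 0]. *)

(** * Directional derivatives of real functions, and the quadratic test functions *)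

Section RealDerivatives.
Context {R : realType}.
Implicit Types (x v w : 'cV[R]_4) (h : 'cV[R]_4 -> R) (B : 'M[R]_4).

Definition coordinate (i : 'I_4) : 'cV[R]_4 -> R := fun x => x i ord0.

Lemma derive_coordinate i v x : 'D_v (coordinate i) x = v i ord0.
Proof.
apply: lim_near_cst => //; apply: filterS (nbhs_dnbhs_neq (0 : R)) => t t0.
by rewrite /coordinate /= !mxE addrK scalerA mulVf // scale1r.
Qed.

(** Both sides are limits of the same difference quotient, by linearity of [B], so the identity
    holds for arbitrary [h]. *)
Lemma derive_mulmx B h v x :
  'D_v (fun y => h (B *m y)) x = 'D_(B *m v) h (B *m x).
Proof.
apply: (congr1 (fun k : R -> R => lim (k @ dnbhs 0)%classic)).
by apply/funext => t /=; rewrite mulmxDr -scalemxAr.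
Qed.

Lemma derive2_mulmx B h v w x :
  'D_w ('D_v (fun y => h (B *m y))) x =
  'D_(B *m w) ('D_(B *m v) h) (B *m x).
Proof.
rewrite -derive_mulmx; congr (derive _ x w).
by apply/funext => y; rewrite derive_mulmx.
Qed.

Lemma derive_sum_partial h v x : differentiable h x ->
  'D_v h x = \sum_(mu < 4) v mu ord0 * partial mu h x.
Proof.
move=> dh; rewrite deriveE // {1}(matrix_sum_delta v) linear_sum /=.
apply: eq_bigr => mu _.
by rewrite big_ord1 linearZ /= /partial deriveE.
Qed.

(** [times_differentiable] speaks of coordinate directions only; expanding [v] in the basis extends
    it to the directions [B *m v] produced by the chain rule. *)
Lemma differentiable_derive h v :
  times_differentiable 2 h -> forall x, differentiable ('D_v h) x.
Proof.
move=> [dh d2h] x.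
have -> : 'D_v h = \sum_(mu < 4) v mu ord0 \*: partial mu h.
  by apply/funext => y; rewrite derive_sum_partial // fct_sumE.
apply: differentiable_sum => mu; apply: differentiableZ.
by have [] := d2h mu.
Qed.

Lemma derive_mul h k v x : differentiable h x -> differentiable k x ->
  'D_v (h * k) x = h x * 'D_v k x + k x * 'D_v h x.
Proof. by move=> dh dk; rewrite deriveM //; apply: diff_derivable. Qed.

Lemma differentiable_coordinate i x : differentiable (coordinate i) x.
Proof. exact: differentiable_coord. Qed.

Definition quadratic i j : 'cV[R]_4 -> R := coordinate i * coordinate j.

Lemma differentiable_quadratic i j x : differentiable (quadratic i j) x.
Proof. by apply: differentiableM; apply: differentiable_coordinate. Qed.

Lemma derive_quadratic i j v :
  'D_v (quadratic i j) =
  v j ord0 \*: coordinate i + v i ord0 \*: coordinate j.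
Proof.
apply/funext => x; rewrite derive_mul ?derive_coordinate;
  try exact: differentiable_coordinate.
by rewrite mulrC [X in _ + X]mulrC.
Qed.

Lemma quadratic0 i j : quadratic i j 0 = 0.
Proof. by rewrite /quadratic /coordinate /GRing.mul /= !mxE mul0r. Qed.

Lemma derive_quadratic0 i j v : 'D_v (quadratic i j) 0 = 0.
Proof.
have := congr1 (@^~ 0) (derive_quadratic i j v) => /= ->.
by rewrite [LHS]/GRing.add /= /coordinate !mxE !scaler0 addr0.
Qed.

Lemma derive2_quadratic i j v w x :
  'D_w ('D_v (quadratic i j)) x =
  w i ord0 * v j ord0 + w j ord0 * v i ord0.
Proof.
have dc k := @diff_derivable _ _ _ _ _ w (differentiable_coordinate k x).
rewrite derive_quadratic deriveD ?deriveZ ?derive_coordinate //;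
  try exact: derivableZ.
by rewrite /GRing.scale /= mulrC [X in _ + X]mulrC.
Qed.

Lemma derive_mul_quadratic0 h i j v : (forall x, differentiable h x) ->
  'D_v (h * quadratic i j) 0 = 0.
Proof.
move=> dh; rewrite derive_mul //; last exact: differentiable_quadratic.
by rewrite quadratic0 derive_quadratic0 mulr0 mul0r addr0.
Qed.

(** In the Leibniz expansion only the term with both derivatives on [quadratic i j] survives, since
    this function and its gradient vanish at the origin. *)
Lemma derive2_mul_quadratic0 h i j v w : times_differentiable 2 h ->
  'D_w ('D_v (h * quadratic i j)) 0 =
  h 0 * (w i ord0 * v j ord0 + w j ord0 * v i ord0).
Proof.
move=> d2h; have [dh _] := d2h.
have dq := differentiable_quadratic i j.
have dDh := differentiable_derive _ v d2h.
have dDq x : differentiable ('D_v (quadratic i j)) x.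
  rewrite derive_quadratic; apply: differentiableD; apply: differentiableZ;
    exact: differentiable_coordinate.
have -> : 'D_v (h * quadratic i j) =
    h * 'D_v (quadratic i j) + 'D_v h * quadratic i j.
  by apply/funext => x; rewrite derive_mul // [X in _ + X]mulrC.
rewrite deriveD; try by apply/diff_derivable/differentiableM.
(* The summand ['D_v h * quadratic i j] is again a differentiable function times the quadratic, so
   its derivative at 0 vanishes. *)
rewrite derive_mul_quadratic0 // addr0 derive_mul //.
by rewrite derive2_quadratic derive_quadratic0 mul0r addr0.
Qed.

Lemma times_differentiable_cst n (k : R) :
  times_differentiable n (cst k : 'cV[R]_4 -> R).
Proof.
elim: n k => [//|n IH] k; split=> [x|mu]; first exact: differentiable_cst.
have -> : partial mu (cst k) = cst 0 by apply/funext => x; exact: derive_cst.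
exact: IH.
Qed.

Lemma times_differentiable_linear n (k l : R) i j :
  times_differentiable n (k \*: coordinate i + l \*: coordinate j).
Proof.
case: n => [//|n]; have dc m x := differentiable_coordinate m x.
split=> [x|mu].
  by apply: differentiableD; apply: differentiableZ.
set e := delta_mx mu ord0 : 'cV[R]_4.
have -> : partial mu (k \*: coordinate i + l \*: coordinate j) =
    cst (k * e i ord0 + l * e j ord0).
  apply/funext => x; have dce m := @diff_derivable _ _ _ _ _ e (dc m x).
  by rewrite /partial deriveD ?deriveZ ?derive_coordinate //;
    apply: derivableZ.
exact: times_differentiable_cst.
Qed.

Lemma times_differentiable_quadratic n i j :
  times_differentiable n (quadratic i j).
Proof.
case: n => [//|n]; split=> [x|mu]; first exact: differentiable_quadratic.
rewrite /partial derive_quadratic; exact: times_differentiable_linear.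
Qed.

End RealDerivatives.

(** * The wave operator at the origin on quadratic test functions *)

Section WaveOperator.
Context {R : realType}.
Implicit Types (a : 'M[R[i]]_4) (b : 'cV[R[i]]_4) (f G : 'cV[R]_4 -> R[i]).

Lemma Re_fun_mul G (q : 'cV[R]_4 -> R) :
  Re_fun (fun x => G x * (q x)%:C) = Re_fun G * q.
Proof.
apply/funext => x; rewrite [RHS]/GRing.mul /= /Re_fun.
by case: (G x) => u v /=; rewrite mulr0 subr0.
Qed.

Lemma Im_fun_mul G (q : 'cV[R]_4 -> R) :
  Im_fun (fun x => G x * (q x)%:C) = Im_fun G * q.
Proof.
apply/funext => x; rewrite [RHS]/GRing.mul /= /Im_fun.
by case: (G x) => u v /=; rewrite mulr0 add0r.
Qed.

Lemma smooth_quadratic i j : smooth (fun x : 'cV[R]_4 => (quadratic i j x)%:C).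
Proof.
move=> n; split; first exact: times_differentiable_quadratic.
exact: (times_differentiable_cst n 0).
Qed.

Lemma smooth_cst (k : R[i]) : smooth (fun=> k : R[i]).
Proof. by move=> n; split; apply: times_differentiable_cst. Qed.

(** At the origin the terms in [b] and [f] drop out and the principal symbol is left. The general
    [B] and [G] serve both frames: the boost with its factor, and the identity with factor 1. *)
Lemma wave_op_quadratic a b f G (B : 'M[R]_4) i j : smooth G ->
  wave_op a b f (fun x => G (B *m x) * (quadratic i j (B *m x))%:C) 0 =
  G 0 * (map_mx (real_complex R) B *m (a + a^T)
         *m (map_mx (real_complex R) B)^T) i j.
Proof.
move=> sG; have [dRe dIm] := sG 2%N.
pose F x := G x * (quadratic i j x)%:C.
have [dRe1 _] := dRe; have [dIm1 _] := dIm.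
have E1 mu : cpartial mu (fun x => F (B *m x)) 0 = 0.
  rewrite /cpartial /partial.
  rewrite -[Re_fun _]/(fun x => Re_fun F (B *m x)).
  rewrite -[Im_fun _]/(fun x => Im_fun F (B *m x)).
  rewrite !derive_mulmx mulmx0 Re_fun_mul Im_fun_mul.
  by rewrite !derive_mul_quadratic0.
have E2 mu nu : cpartial mu (cpartial nu (fun x => F (B *m x))) 0 =
    G 0 * (B i mu * B j nu + B j mu * B i nu)%:C.
  have -> : cpartial mu (cpartial nu (fun x => F (B *m x))) 0 =
      partial mu (partial nu (fun x => Re_fun F (B *m x))) 0
      +i* partial mu (partial nu (fun x => Im_fun F (B *m x))) 0 by [].
  rewrite /partial.
  rewrite !derive2_mulmx !mulmx0 Re_fun_mul Im_fun_mul.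
  rewrite !derive2_mul_quadratic0 //.
  (* The image under [B] of the basis vector [mu] is column [mu] of [B]. *)
  rewrite -!colE !mxE /Re_fun /Im_fun.
  by case: (G 0) => u v; apply/eqP; rewrite eq_complex /= !mulr0 subr0 add0r !eqxx.
rewrite /wave_op -/F mulmx0 quadratic0 !mulr0 addr0.
rewrite [X in _ + X]big1 => [|mu _]; last by rewrite E1 mulr0.
rewrite addr0.
pose B' := map_mx (real_complex R) B.
have sumE k l : (B' *m a *m B'^T) k l =
    \sum_mu \sum_nu a mu nu * (B k mu * B l nu)%:C.
  rewrite mxE exchange_big /=; apply: eq_bigr => nu _.
  rewrite !mxE mulr_suml; apply: eq_bigr => mu _.
  by rewrite !mxE rmorphM /=; ring.
(* The Hessian of the test function is symmetric in [i] and [j]; its swapped half is the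
   contribution of [a^T]. *)
have symE : (B' *m a^T *m B'^T) i j = (B' *m a *m B'^T) j i.
  have -> : B' *m a^T *m B'^T = (B' *m a *m B'^T)^T.
    by rewrite !trmx_mul trmxK mulmxA.
  by rewrite mxE.
rewrite mulmxDr mulmxDl mxE symE !sumE -big_split mulr_sumr /=.
apply: eq_bigr => mu _; rewrite -big_split mulr_sumr /=.
apply: eq_bigr => nu _; rewrite E2 rmorphD /=; ring.
Qed.

End WaveOperator.

(** * The boost with velocity [c e_1] as a matrix *)

Section UnitBoost.
Context {R : realType}.

Definition shear (t : R) : 'M[R]_4 := 1%:M + t *: delta_mx (lift ord0 ord0) ord0.

(** The off-diagonal matrix unit squares to zero, so the parameters add; in particular [shear (- 1)]
    inverts [shear 1]. *)
Lemma mulmx_shear (s t : R) : shear s *m shear t = shear (s + t).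
Proof.
rewrite /shear mulmxDl mul1mx mulmxDr mulmx1 -scalemxAl -scalemxAr.
by rewrite mul_delta_mx_0 // !scaler0 addr0 scalerDl addrA addrAC.
Qed.

Lemma shear0 : shear 0 = 1%:M.
Proof. by rewrite /shear scale0r addr0. Qed.

Lemma boost_frame_shear (c : R) (x x' : 'cV[R]_4) : c != 0 ->
  boost_frame c (c *: delta_mx ord0 ord0) x x' -> x' = shear (- 1) *m x.
Proof.
move=> c0 [tE rE].
have {}tE : x ord0 ord0 = x' ord0 ord0 by apply: (mulIf (invr_neq0 c0)).
suff -> : x = shear 1 *m x'.
  by rewrite mulmxA mulmx_shear addNr shear0 mul1mx.
apply/matrixP => k l; rewrite (ord1 l) {l}.
rewrite mulmxDl mul1mx -scalemxAl scale1r.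
have -> : (delta_mx (lift ord0 ord0) ord0 : 'M[R]_4) *m x' =
    x' ord0 ord0 *: delta_mx (lift ord0 ord0) ord0.
  apply/matrixP => p q; rewrite (ord1 q) !mxE (bigD1 ord0) //= big1 => [|m m0].
    by rewrite !mxE eqxx andbT addr0 mulrC eq_sym.
  by rewrite !mxE (negPf m0) andbF mul0r.
rewrite !mxE; case: (unliftP ord0 k) => [m ->|->]; last first.
  by rewrite /= mulr0 addr0.
move/matrixP: rE => /(_ m ord0).
(* The displacement along [e_1] is [c] times the time [x^0 / c], that is [x^0]. *)
rewrite !mxE /time mulrA divfK //.
have <- : lift ord0 m = rshift 1 m by apply/val_inj.
by move=> ->; rewrite (inj_eq (@lift_inj _ ord0)) eqxx.
Qed.

Lemma boost_frame0 (c : R) (v : 'cV[R]_3) : boost_frame c v 0 0.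
Proof.
split=> //; rewrite /time mxE mul0r scale0r addr0 //.
Qed.

End UnitBoost.

(** * Comparison of the principal symbols in the two frames *)

Theorem theorem1 (R : realType) (c : R) (a : 'M[R[i]]_4) (b : 'cV[R[i]]_4)
    (f : 'cV[R]_4 -> R[i]) :
  0 < c -> galilean_covariant c a b f -> a ord0 ord0 = 0.
Proof.
move=> /lt0r_neq0 c0 [_ /(_ (c *: delta_mx ord0 ord0))[g [sg g0 cov]]].
(* Since [x = shear 1 *m x'], this is the function [f'] prescribed by the scalar law. *)
have [|lambda [_ {}cov]] := cov (fun x' => f (shear 1 *m x')).
  move=> x x' /(boost_frame_shear _ _ _ c0) ->.
  by rewrite mulmxA mulmx_shear subrr shear0 mul1mx.
pose N := map_mx (real_complex R) (shear (- 1)).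
pose S := a + a^T.
have symbol i j : g 0 * (N *m S *m N^T) i j = lambda 0 * S i j.
  rewrite -(wave_op_quadratic a b f g (shear (- 1)) i j sg).
  pose f' x' := f (shear 1 *m x').
  have := wave_op_quadratic a b f' (fun=> 1) 1%:M i j (smooth_cst 1).
  rewrite map_mx1 trmx1 mulmx1 mul1mx mul1r => <-.
  under [in RHS]eq_fun do rewrite mul1mx mul1r.
  apply: cov; [exact: smooth_quadratic| |exact: boost_frame0].
  (* With [Psi'] the quadratic, the transformation law gives [Psi] as [g] times this quadratic, both
     evaluated at [shear (- 1) *m x]. *)
  by move=> x x' /(boost_frame_shear _ _ _ c0) ->.
pose one : 'I_4 := lift ord0 ord0.
have NSN i j : (N *m S *m N^T) i j = (row i N *m S *m (row j N)^T) ord0 ord0.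
  by rewrite -row_mul !mxE; apply: eq_bigr => k _; rewrite !mxE.
have N0 : row ord0 N = delta_mx ord0 ord0.
  apply/rowP => k; rewrite !mxE mulr0 addr0 /= [k == _]eq_sym.
  by case: (_ == _).
have N1 : row one N = delta_mx ord0 one - delta_mx ord0 ord0.
  apply/rowP => k; rewrite !mxE mulN1r rmorphB /= [k == one]eq_sym.
  by case: (_ == k); case: (k == _).
have S00 : g 0 * S ord0 ord0 = lambda 0 * S ord0 ord0.
  by rewrite -symbol NSN N0 trmx_delta -rowE -colE !mxE.
have S01 : g 0 * (S ord0 one - S ord0 ord0) = lambda 0 * S ord0 one.
  rewrite -symbol NSN N0 N1 linearB /= !trmx_delta -rowE mulmxBr -!colE.
  by rewrite !mxE.
(* The diagonal entry of [a + a^T] is twice that of [a], and 2 is cancelled. *)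
suff /eqP : S ord0 ord0 = 0 by rewrite !mxE -mulr2n mulrn_eq0 => /eqP.
apply/eqP; apply: contraT => S00_neq0.
move/(mulIf S00_neq0): S00 => gl; move: S01; rewrite -gl mulrBr => /eqP.
by rewrite subr_eq addrC -subr_eq subrr eq_sym mulf_eq0 (negPf (g0 0)) (negPf S00_neq0).
Qed.
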